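(* Every graph $G$ admits an arithmetic integer additive set-indexer.
   Context: All graphs are simple, finite and have no isolated vertices. $\mathbb{N}_0$ is the set of non-negative integers; all sets considered are finite. For $A,B\subseteq\mathbb{N}_0$, $A+B=\{a+b: a\in A, b\in B\}$. An integer additive set-indexer (IASI) of $G$ is an injective function $f:V(G)\to 2^{\mathbb{N}_0}$ such that the induced function $f^+:E(G)\to 2^{\mathbb{N}_0}$, $f^+(uv)=f(u)+f(v)$, is also injective. An AP-set is a finite set of non-negative integers whose elements, in increasing order, form an arithmetic progression. An arithmetic IASI is an IASI $f$ such that $f(v)$ is an AP-set for every vertex $v$ and $f^+(e)$ is an AP-set for every edge $e$. *)

(* Defs.v *)
From mathcomp Require Import all_boot.
From mathcomp Require Import finmap.

Set Implicit Arguments.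
Unset Strict Implicit.
Unset Printing Implicit Defensive.

Local Open Scope fset_scope.

Record sgraph := SGraph {
  vertex :> finType;
  adj : rel vertex;
  adj_sym : symmetric adj;
  adj_irrefl : irreflexive adj
}.

Definition no_isolated_vertex (G : sgraph) : Prop :=
  forall u : G, exists v : G, adj u v.

Definition sumset (A B : {fset nat}) : {fset nat} :=
  [fset (a + b)%N | a in A, b in B].

(* f^+(uv) = f(u) + f(v) does not depend on the order of the endpoints. *)
Lemma sumsetC (A B : {fset nat}) : sumset A B = sumset B A.
Proof.
by apply/fsetP => x; apply/imfset2P/imfset2P => -[a Aa [b Bb ->]];
  exists b => //; exists a => //; rewrite addnC.
Qed.

(* The edge uv is the unordered pair [set u; v], so the last clause is the
   injectivity of f^+ on the edge set. *)
Definition IASI (G : sgraph) (f : G -> {fset nat}) : Prop :=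
  injective f /\
  forall u v x y : G, adj u v -> adj x y ->
    sumset (f u) (f v) = sumset (f x) (f y) -> [set u; v]%SET = [set x; y]%SET.

Definition arith_progression (s : seq nat) : Prop :=
  exists a d : nat, s = [seq (a + i * d)%N | i <- iota 0 (size s)].

(* A progression has a first term, so the empty set is excluded; singletons
   are (degenerate) progressions. *)
Definition AP_set (A : {fset nat}) : Prop :=
  A != fset0 /\ arith_progression (sort leq (enum_fset A)).

Definition arithmetic_IASI (G : sgraph) (f : G -> {fset nat}) : Prop :=
  [/\ IASI f,
      forall v : G, AP_set (f v) &
      forall u v : G, adj u v -> AP_set (sumset (f u) (f v))].

(* Main.v *)
(** Label the vertex of rank [i] with the three-term progression
    [2^i, 2^i + 1, 2^i + 2]. The sumset of two intervals is an interval that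
    starts at the sum of the two starting points, so an edge label determines
    [2^i + 2^j], and hence [{i, j}] by uniqueness of binary expansions. *)

Require Import Defs.
From mathcomp Require Import all_boot.
From mathcomp Require Import finmap.
From mathcomp Require Import zify.

Set Implicit Arguments.
Unset Strict Implicit.
Unset Printing Implicit Defensive.

Local Open Scope fset_scope.
Local Open Scope nat_scope.

(** The parameter [n] is the length, one less than the cardinality, so that lengths add under
    [sumset]. *)
Definition fset_interval (a n : nat) : {fset nat} :=
  [fset x | x in iota a n.+1].

Lemma in_fset_interval (a n x : nat) :
  (x \in fset_interval a n) = (a <= x <= a + n).
Proof. by rewrite in_fset mem_iota addnS ltnS. Qed.

(** Each left end lies in the other interval, whence [a <= b] and [b <= a]. *)
Lemma fset_interval_inj (a b n : nat) :
  fset_interval a n = fset_interval b n -> a = b.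
Proof.
move=> /fsetP eq_ab; apply/eqP; rewrite eqn_leq.
have := eq_ab a; have := eq_ab b.
by rewrite !in_fset_interval !leqnn !leq_addr => /andP[-> _] /esym /andP[].
Qed.

Lemma sumset_interval (a b m n : nat) :
  sumset (fset_interval a m) (fset_interval b n) = fset_interval (a + b) (m + n).
Proof.
apply/fsetP => x; rewrite in_fset_interval; apply/imfset2P/idP => /=.
  move=> [y + [z + ->]]; rewrite !in_fset_interval.
  lia.
(* Up to [a + b + m] the second summand can stay at its minimum [b]; beyond that the first is fixed
   at its maximum [a + m]. *)
move=> abx; have [xbm|bmx] := leqP x (a + b + m).
  by exists (x - b); [|exists b]; rewrite ?in_fset_interval; lia.
by exists (a + m); [|exists (x - (a + m))]; rewrite ?in_fset_interval; lia.
Qed.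

Lemma AP_set_interval (a n : nat) : AP_set (fset_interval a n).
Proof.
split; first by apply/fset0Pn; exists a; rewrite in_fset_interval leqnn leq_addr.
(* Two sorted lists that are permutations of each other coincide. *)
have -> : sort leq (enum_fset (fset_interval a n)) = iota a n.+1.
  apply: (sorted_eq leq_trans anti_leq); rewrite ?iota_sorted //.
    exact: sort_sorted leq_total _.
  rewrite perm_sort; apply: uniq_perm; rewrite ?iota_uniq ?fset_uniq // => x.
  by rewrite mem_iota addnS ltnS -in_fset_interval.
exists a, 1; rewrite size_iota -[in LHS](addn0 a) iotaDl.
by apply: eq_map => i; rewrite muln1.
Qed.

(** Since [2 ^ i < 2 ^ j], the sum stays below [2 ^ j.+1]. *)
Lemma trunc_log_expD (i j : nat) : i < j -> trunc_log 2 (2 ^ i + 2 ^ j) = j.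
Proof.
move=> ij; apply: trunc_log_eq => //; rewrite leq_addl /=.
by rewrite expnS mul2n -addnn ltn_add2r ltn_exp2l.
Qed.

(** The binary logarithm recovers the larger exponent; cancelling its power leaves the smaller
    one. *)
Lemma expD_ltn_inj (i j k l : nat) : i < j -> k < l ->
  2 ^ i + 2 ^ j = 2 ^ k + 2 ^ l -> i = k /\ j = l.
Proof.
move=> ij kl eq_sum.
have jl : j = l by rewrite -(trunc_log_expD ij) eq_sum trunc_log_expD.
by move: eq_sum; rewrite jl => /addIn /expnI ->.
Qed.

Lemma expD_neq_inj (i j k l : nat) : i != j -> k != l ->
  2 ^ i + 2 ^ j = 2 ^ k + 2 ^ l -> i = k /\ j = l \/ i = l /\ j = k.
Proof.
rewrite !neq_ltn => /orP[ij|ji] /orP[kl|lk].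
- by move=> /(expD_ltn_inj ij kl); left.
- by rewrite [RHS]addnC => /(expD_ltn_inj ij lk); right.
- by rewrite addnC => /(expD_ltn_inj ji kl) [-> ->]; right.
- by rewrite addnC [RHS]addnC => /(expD_ltn_inj ji lk) [-> ->]; left.
Qed.

Theorem theorem3p1 (G : sgraph) (hG : no_isolated_vertex G) :
  exists f : G -> {fset nat}, arithmetic_IASI f.
Proof.
have rank_inj (u v : G) : enum_rank u = enum_rank v :> nat -> u = v.
  by move=> /ord_inj /enum_rank_inj.
have rank_neq (u v : G) : adj u v -> enum_rank u != enum_rank v :> nat.
  by apply: contraTneq => /rank_inj ->; rewrite adj_irrefl.
exists (fun v : G => fset_interval (2 ^ enum_rank v) 2); split.
- split=> [u v /fset_interval_inj /expnI /rank_inj -> //|u v x y uv xy].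
  (* All edge labels have the same length [2 + 2], so equal labels have equal left ends. *)
  rewrite !sumset_interval => /fset_interval_inj.
  move=> /(expD_neq_inj (rank_neq _ _ uv) (rank_neq _ _ xy)).
  (* The two cases are the two orientations of the same edge. *)
  by case=> -[/rank_inj -> /rank_inj ->] //; rewrite setUC.
- by move=> v; apply: AP_set_interval.
- by move=> u v _; rewrite sumset_interval; apply: AP_set_interval.
Qed.
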